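(* Let $X$ be a Banach space with the Radon–Nikodym property, let $\Omega\subset X$ be a convex domain with quasihyperbolic metric $k=k_\Omega$, and let $x_0,x\in\Omega$ with $x_0\ne x$. Put $r=k(x_0,x)$ and suppose that $\gamma\colon[0,1]\to\Omega$ is a quasihyperbolic geodesic with $\gamma(0)=x_0$ and $\gamma(1)=x$. Then $$\lim_{t\to1^-}\frac{d_{\|\cdot\|}(\gamma(t),\mathbf S_k(x_0,r))}{\|\gamma(t)-\gamma(1)\|}=1.$$ The same holds with the norm distance replaced by $k$, i.e. $$\lim_{t\to1^-}\frac{d_{k}(\gamma(t),\mathbf S_k(x_0,r))}{k(\gamma(t),\gamma(1))}=1.$$
   Context: Banach spaces are real. A domain $\Omega\subset X$ is an open path-connected subset with non-empty boundary $\partial\Omega$. Write $d(z,\partial\Omega)$ for the norm distance from $z$ to $\partial\Omega$. The quasihyperbolic metric on $\Omega$ is $$k_\Omega(x,y)=\inf_\gamma\int_\gamma\frac{\|dz\|}{d(z,\partial\Omega)},$$ the infimum being over all rectifiable curves $\gamma$ in $\Omega$ joining $x$ and $y$; a curve attaining the infimum is called a quasihyperbolic geodesic. Geodesics are parametrized proportionally to quasihyperbolic length (constant quasihyperbolic speed). $\mathbf B_k(x_0,r)=\{y\in\Omega: k(x_0,y)\le r\}$ and $\mathbf S_k(x_0,r)=\partial\mathbf B_k(x_0,r)$. For a point $p$ and a set $A$, $d_{\|\cdot\|}(p,A)=\inf_{a\in A}\|p-a\|$ and $d_k(p,A)=\inf_{a\in A}k(p,a)$. $X$ has the Radon–Nikodym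 property if each Lipschitz path $\gamma\colon[0,1]\to X$ is a.e. differentiable and $\gamma(t)=\gamma(0)+\int_0^t\gamma'(s)\,ds$ for all $t\in[0,1]$. *)

(* Defs.v *)
From HB Require Import structures.
From mathcomp Require Import all_boot all_order all_algebra.
From mathcomp Require Import all_classical all_reals all_analysis.

Set Implicit Arguments.
Unset Strict Implicit.
Unset Printing Implicit Defensive.

Import Order.TTheory GRing.Theory Num.Theory.
Import numFieldNormedType.Exports.

Local Open Scope classical_set_scope.
Local Open Scope ring_scope.

(** A path on [a, b] is a total function [R -> X] of which only the values on
    [a, b] matter. *)

Section bochner.
Context {d : measure_display} {T : measurableType d} {R : realType}.
Context {X : normedModType R} (mu : {measure set T -> \bar R}).

Definition bochner_simple (D : set T) (s : {fimfun T >-> X}) : Prop :=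
  forall y, measurable (s @^-1` [set y]) /\
    (y != 0 -> (mu (D `&` s @^-1` [set y]) < +oo)%E).

Definition simple_integral (D : set T) (s : {fimfun T >-> X}) : X :=
  \sum_(y \in range s) fine (mu (D `&` s @^-1` [set y])) *: y.

(** [f] is Bochner integrable on [D], with integral [v]. The a.e. convergence
    is the strong measurability of [f]. *)
Definition is_bochner_integral (D : set T) (f : T -> X) (v : X) : Prop :=
  exists s : nat -> {fimfun T >-> X},
    [/\ forall n, bochner_simple D (s n),
        {ae mu, forall t, D t -> s n t @[n --> \oo] --> f t},
        (\int[mu]_(t in D) (`|f t - s n t|)%:E)%E @[n --> \oo] --> 0%E &
        simple_integral D (s n) @[n --> \oo] --> v].

End bochner.

Definition radon_nikodym_property (R : realType) (X : normedModType R) : Prop :=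
  forall g : R -> X, [lipschitz g t | t in `[0, 1]%classic] ->
    {ae lebesgue_measure, forall t : R, t \in `]0, 1[ -> derivable g t 1} /\
    forall t : R, t \in `[0, 1] ->
      is_bochner_integral lebesgue_measure `[0, t]%classic ('D_1 g) (g t - g 0).

Section quasihyperbolic.
Context {R : realType} {X : normedModType R}.
Implicit Types (A Om : set X) (g : R -> X) (x y z : X) (a b r : R).

Definition boundary A : set X := closure A `\` A^°.

Definition norm_dist z A : R := inf [set `|z - a| | a in A].

Definition path_in A g : Prop :=
  {within `[0, 1]%classic, continuous g} /\ forall t : R, t \in `[0, 1] -> A (g t).

Definition path_connected A : Prop :=
  forall x y, A x -> A y -> exists g, [/\ path_in A g, g 0 = x & g 1 = y].

Definition domain Om : Prop :=
  [/\ open Om, path_connected Om & boundary Om !=set0].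

(** [numfun.variation] and [realfun.total_variation], for [X]-valued paths. *)
Definition path_variation a b g (s : seq R) : R :=
  let F := g \o nth b (a :: s) in \sum_(0 <= n < size s) `|F n.+1 - F n|.

Definition path_length a b g : \bar R :=
  ereal_sup [set (path_variation a b g s)%:E | s in itv_partition a b].

Definition rectifiable a b g : Prop := (path_length a b g < +oo)%E.

(** Arc length parametrization on [0, L] of the restriction of [g] to [a, b],
    where [L] is the length. *)
Definition arclength_param a b g (s : R) : X :=
  g (inf [set t | t \in `[a, b] /\ (s%:E <= path_length a t g)%E]).

(** Integral of [rho] with respect to arc length; meaningful for continuous
    rectifiable paths. *)
Definition line_integral (rho : X -> R) a b g : \bar R :=
  \int[lebesgue_measure]_(s in `[0%R, fine (path_length a b g)]%classic)
    (rho (arclength_param a b g s))%:E.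

Definition qh_length Om a b g : \bar R :=
  line_integral (fun z => (norm_dist z (boundary Om))^-1) a b g.

Definition joining Om x y : set (R -> X) :=
  [set g | [/\ path_in Om g, rectifiable 0 1 g, g 0 = x & g 1 = y]].

(** The infimum is finite when [Om] is a domain containing [x] and [y]. *)
Definition qh_dist Om x y : R :=
  fine (ereal_inf [set qh_length Om 0 1 g | g in joining Om x y]).

(** The last clause is the constant speed parametrization. *)
Definition qh_geodesic Om g : Prop :=
  [/\ joining Om (g 0) (g 1) g,
      qh_length Om 0 1 g = (qh_dist Om (g 0) (g 1))%:E &
      forall t : R, t \in `[0, 1] ->
        qh_length Om 0 t g = (t%:E * qh_length Om 0 1 g)%E].

Definition qh_ball Om x r : set X := [set y | Om y /\ qh_dist Om x y <= r].

Definition qh_sphere Om x r : set X := boundary (qh_ball Om x r).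

Definition qh_dist_set Om z A : R := inf [set qh_dist Om z a | a in A].

End quasihyperbolic.

(* Main.v *)
Require Import Defs.
From HB Require Import structures.
From mathcomp Require Import all_boot all_order all_algebra.
From mathcomp Require Import all_classical all_reals all_analysis.
From mathcomp Require Import ring lra.

(** Write d(z) for the distance from z to the boundary of the domain, k for the
    quasihyperbolic distance, S for the sphere, and put delta = |gamma(t) - x|.

    The second limit holds because its ratio is identically 1. Along the
    geodesic k(x0, gamma(t)) <= t r and k(gamma(t), x) <= (1 - t) r
    ([geodesic_dist_le]), while every z in S has k(x0, z) >= r, so the triangle
    inequality gives k(gamma(t), z) >= (1 - t) r ([geodesic_sphere_ge]). As x
    itself lies on S, the distance from gamma(t) to S is k(gamma(t), x).

    The first limit follows from this by comparing k with the norm near x. A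
    point y of S closer to gamma(t) than x lies in the ball of radius 2 delta
    about x, where the density 1/d is at most 1/(d(x) - 2 delta); hence
    (1 - t) r <= k(gamma(t), y) <= |gamma(t) - y| / (d(x) - 2 delta)
    ([qh_dist_near]). Conversely, a curve ending at x has density at least
    1/(d(x) + l) at arc length l before its end, so that
    k(gamma(t), x) >= ln(1 + delta/d(x)) >= delta/(d(x) + delta)
    ([qh_dist_ln_lb]). The ratio is therefore at least
    (d(x) - 2 delta)/(d(x) + delta), which tends to 1
    ([geodesic_norm_dist_sphere]).

    Two facts about S are needed. It is contained in the domain, because the
    logarithmic bound keeps balls away from the boundary ([qh_sphere_sub]). And
    it contains x, which is where convexity matters: d is concave
    ([dist_concave]), so the contraction of ratio s < 1 towards x0 shortens
    quasihyperbolic length by a definite amount and k(x0, x) < k(x0, y) for y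
    slightly beyond x on the ray from x0 ([qh_dist_shrink]); so x is not
    interior to the ball.

    All of this manipulates k through Lipschitz curves: k(u, v) is the infimum
    of the integrals of 1/d along 1-Lipschitz curves from u to v, whatever their
    parametrization ([qh_dist_le], [qh_dist_approx]). One half says that the
    arc length parametrization is 1-Lipschitz ([arctime_lip]); the other that a
    C-Lipschitz curve has quasihyperbolic length at most C times the integral
    of the density over its parameter ([qh_length_lip]). *)

Set Implicit Arguments.
Unset Strict Implicit.
Unset Printing Implicit Defensive.

Import Order.TTheory GRing.Theory Num.Theory.
Import numFieldNormedType.Exports.

Local Open Scope classical_set_scope.
Local Open Scope ring_scope.

(** * Integrals of continuous functions over segments *)

Section itv_integral.
Context {R : realType}.
Implicit Types (h : R -> R) (a b c k m D L s : R).

Definition itv_int h a b : R := \int[lebesgue_measure]_(s in `[a, b]) h s.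

Lemma continuous_itv_integrable h a b : continuous h ->
  (@lebesgue_measure R).-integrable `[a, b] (EFin \o h).
Proof.
move=> ch; apply: continuous_compact_integrable; first exact: segment_compact.
exact: continuous_subspaceT.
Qed.

Lemma itv_intE h a b : continuous h ->
  (\int[lebesgue_measure]_(s in `[a, b]) (h s)%:E)%E = (itv_int h a b)%:E.
Proof.
move=> ch; rewrite /itv_int /Rintegral fineK//.
by apply: integrable_fin_num => //; exact: continuous_itv_integrable.
Qed.

Lemma itv_int_split h a b c : continuous h -> a <= b -> b <= c ->
  itv_int h a c = itv_int h a b + itv_int h b c.
Proof.
move=> ch ab bc.
have := @Rintegral_itvB R h (BLeft a) (BRight c) b
  (@continuous_itv_integrable h a c ch).
rewrite !bnd_simp => /(_ ab bc) E.
have E2 : itv_int h b c = \int[lebesgue_measure]_(x in `]b, c]) h x.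
  rewrite /itv_int -Rintegral_itv_obnd_cbnd//.
  apply: integrableS (@continuous_itv_integrable h b c ch) => //.
  by move=> s /=; rewrite !in_itv/= => /andP[/ltW -> ->].
by rewrite E2 -E /itv_int addrC subrK.
Qed.

Lemma itv_int_le h1 h2 a b : continuous h1 -> continuous h2 ->
  (forall s, a <= s <= b -> h1 s <= h2 s) -> itv_int h1 a b <= itv_int h2 a b.
Proof.
move=> c1 c2 h12; apply: le_Rintegral => //.
- exact: continuous_itv_integrable.
- exact: continuous_itv_integrable.
Qed.

Lemma eq_itv_int h1 h2 a b : (forall s, a <= s <= b -> h1 s = h2 s) ->
  itv_int h1 a b = itv_int h2 a b.
Proof.
by move=> h12; apply: eq_Rintegral => s; rewrite inE/= in_itv/=; exact: h12.
Qed.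

Lemma itv_int_cst m a b : a <= b -> itv_int (cst m) a b = m * (b - a).
Proof.
move=> ab; rewrite /itv_int Rintegral_cst//= lebesgue_measure_itv/=.
case: ifPn => //; rewrite lte_fin -leNgt => ba.
by have -> : a = b; [lra|rewrite subrr].
Qed.

Lemma itv_int_lb h a b m : continuous h -> a <= b ->
  (forall s, a <= s <= b -> m <= h s) -> m * (b - a) <= itv_int h a b.
Proof.
move=> ch ab mh; rewrite -itv_int_cst//; apply: itv_int_le => //.
by move=> ?; exact: cvg_cst.
Qed.

Lemma itv_int_ub h a b m : continuous h -> a <= b ->
  (forall s, a <= s <= b -> h s <= m) -> itv_int h a b <= m * (b - a).
Proof.
move=> ch ab mh; rewrite -itv_int_cst//; apply: itv_int_le => //.
by move=> ?; exact: cvg_cst.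
Qed.

Lemma itv_int_ge0 h a b : (forall s, a <= s <= b -> 0 <= h s) ->
  0 <= itv_int h a b.
Proof.
by move=> h0; apply: Rintegral_ge0 => s /=; rewrite in_itv/=; exact: h0.
Qed.

Lemma itv_int_axpb h a b k m : continuous h -> a <= b ->
  itv_int (fun s => k * h s + m) a b = k * itv_int h a b + m * (b - a).
Proof.
move=> ch ab; have ckh : continuous (fun s => k * h s).
  by move=> x; apply: cvgM; [exact: cvg_cst|exact: ch].
have cm : continuous (cst m : R -> R) by move=> x; exact: cvg_cst.
rewrite -itv_int_cst// /itv_int RintegralD//; last 2 first.
- exact: continuous_itv_integrable.
- exact: continuous_itv_integrable.
by rewrite RintegralZl//; exact: continuous_itv_integrable.
Qed.

Lemma itv_int_affine h a b c k : continuous h -> a <= b -> 0 < k ->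
  itv_int h (k * a + c) (k * b + c) = k * itv_int (fun s => h (k * s + c)) a b.
Proof.
move=> ch ab k0; pose F s := k * s + c.
have dF : derive1 F = cst k :> (R -> R).
  apply/funext => x; rewrite derive1E /F deriveD// derive_cst addr0.
  by rewrite deriveM// derive_id derive_cst scaler0 addr0 /GRing.scale/= mulr1.
have cF : continuous F.
  move=> x; apply: cvgD; last exact: cvg_cst.
  by apply: cvgM; [exact: cvg_cst|exact: cvg_id].
have chF : continuous (h \o F).
  by move=> x; apply: (@continuous_comp _ _ _ F h); [exact: cF|exact: ch].
have E : k * itv_int (h \o F) a b = itv_int (fun s => h (F s) * k) a b.
  rewrite /itv_int -RintegralZl//; last exact: continuous_itv_integrable.
  by apply: eq_Rintegral => s _; rewrite mulrC.
rewrite [RHS]E; apply: EFin_inj; rewrite -!itv_intE//; last first.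
  by move=> x; apply: cvgM; [exact: chF|exact: cvg_cst].
rewrite (@integration_by_substitution_increasing R F)//.
- by apply: eq_integral => x _; rewrite !fctE dF.
- by move=> x y _ _ xy; rewrite ltrD2r ltr_pM2l.
- by move=> x _; rewrite dF; exact: cvg_cst.
- by rewrite dF; exact: is_cvg_cst.
- by rewrite dF; exact: is_cvg_cst.
- split=> [x _||]; first by apply: derivableD => //; exact: derivableM.
  + exact/cvg_at_right_filter/cF.
  + exact/cvg_at_left_filter/cF.
- exact: continuous_subspaceT.
Qed.

(** The bound is the exact integral of 1/(D + L - s), whose primitive is
    -ln(D + L - s). *)
Lemma itv_int_inv_lb h D L : continuous h -> 0 < D -> 0 <= L ->
  (forall s, 0 <= s <= L -> (D + (L - s))^-1 <= h s) ->
  ln (1 + L / D) <= itv_int h 0 L.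
Proof.
move=> ch D0 L0 Dh.
have [<-|Lpos] := eqVneq 0 L.
  by rewrite mul0r addr0 ln1; apply: itv_int_ge0 => s sL;
    apply: le_trans (Dh s _); rewrite ?invr_ge0; lra.
have {L0 Lpos}Lpos : 0 < L by lra.
pose g s : R := (D + (L - s))^-1; pose F s : R := - ln (D + (L - s)).
have dl s : is_derive s (1 : R) (fun s : R => D + (L - s) : R) (- 1 : R).
  by apply: is_derive_eq; rewrite !add0r !mul1r.
have dF s : s < L + D -> is_derive s (1 : R) F (g s).
  move=> sL; rewrite /F /g.
  have := @is_derive1_comp R (@ln R) (fun s : R => D + (L - s) : R) s _ _
    (is_derive1_ln (_ : 0 < D + (L - s))) (dl s).
  move=> /(_ ltac:(lra)) H.
  by apply: is_derive_eq; rewrite mulrN1 opprK.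
have cg : {within `[0, L], continuous g}.
  apply: continuous_in_subspaceT => s; rewrite inE/= in_itv/= => sL.
  apply: cvgV; first by apply/lt0r_neq0; lra.
  by apply: cvgD; [exact: cvg_cst|apply: cvgB; [exact: cvg_cst|exact: cvg_id]].
have cF s : s < L + D -> {for s, continuous F}.
  by move=> sL; apply: differentiable_continuous; apply/derivable1_diffP;
    apply: ex_derive; exact: dF.
have dLR : derivable_oo_LRcontinuous F 0 L.
  split.
  - by move=> s; rewrite in_itv/= => sL; apply: ex_derive; apply: dF; lra.
  - by apply: cvg_at_right_filter; apply: cF; lra.
  - by apply: cvg_at_left_filter; apply: cF; lra.
have dFg : {in `]0, L[, derive1 F =1 g}.
  move=> s; rewrite in_itv/= => sL; rewrite derive1E.
  by apply: derive_val; apply: dF; lra.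
have E := continuous_FTC2 Lpos cg dLR dFg.
have ig : (@lebesgue_measure R).-integrable `[0, L] (EFin \o g).
  by apply: continuous_compact_integrable => //; exact: segment_compact.
apply: (@le_trans _ _ (itv_int g 0 L)); last first.
  by apply: le_Rintegral => //; exact: continuous_itv_integrable.
rewrite /itv_int /Rintegral E /= /F subr0 subrr addr0 opprK addrC.
rewrite -ln_div ?posrE//; last by lra.
by rewrite mulrDl divff ?gt_eqF.
Qed.

End itv_integral.

(** * The distance to the boundary of a convex domain *)

Section distance_to_boundary.
Context {R : realType} {X : normedModType R}.
Implicit Types (A Om : set X) (x y z u v w : X) (s t m : R).

Lemma norm_dist_le z A a : A a -> norm_dist z A <= `|z - a|.
Proof. by move=> Aa; apply: ge_inf; [exists 0 => _ [b _ <-]|exists a]. Qed.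

Lemma le_norm_dist z A m : A !=set0 -> (forall a, A a -> m <= `|z - a|) ->
  m <= norm_dist z A.
Proof.
move=> [a Aa] mA; apply: lb_le_inf; first by exists `|z - a|; exists a.
by move=> _ [b Ab <-]; exact: mA.
Qed.

Lemma norm_dist_lip A z w : A !=set0 ->
  norm_dist z A <= norm_dist w A + `|z - w|.
Proof.
move=> A0; rewrite -lerBlDr; apply: le_norm_dist => // a Aa; rewrite lerBlDr.
apply: (le_trans (norm_dist_le z Aa)).
by rewrite [leRHS]addrC; exact: ler_distD.
Qed.

Lemma norm_dist_mem_le0 A z : A z -> norm_dist z A <= 0.
Proof. by move=> /norm_dist_le - /(_ z); rewrite subrr normr0. Qed.

Lemma open_normP Om : open Om <->
  forall z, Om z -> exists2 e : R, 0 < e & forall w, `|z - w| < e -> Om w.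
Proof.
rewrite openE; split=> oOm z /oOm.
  move=> /nbhs_ballP[e /= e0 H]; exists e => // w zw; apply: H.
  by rewrite -ball_normE.
move=> [e e0 H]; apply/nbhs_ballP; exists e => //= w.
by rewrite -ball_normE; exact: H.
Qed.

Lemma closure_normP A z : closure A z <->
  forall e : R, 0 < e -> exists2 w, A w & `|z - w| < e.
Proof.
split=> [cA e e0|H B /nbhs_ballP[e /= e0 eB]].
  have [w [Aw]] := cA _ (nbhsx_ballx z e e0).
  by rewrite -ball_normE /= => zw; exists w.
have [w Aw zw] := H e e0; exists w; split=> //.
by apply: eB; rewrite -ball_normE.
Qed.

Lemma open_boundaryE Om z : open Om ->
  boundary Om z <-> closure Om z /\ ~ Om z.
Proof. by move=> /interior_id oOm; rewrite /boundary oOm. Qed.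

(** The point sought is the last one reached by the segment from u to w while
    it stays in the set. *)
Lemma boundary_crossing Om u w : open Om -> Om u -> ~ Om w ->
  exists2 b, boundary Om b & `|u - b| <= `|u - w|.
Proof.
move=> oOm Omu nOmw; pose p t := u + t *: (w - u).
have pB s t : `|p s - p t| = `|s - t| * `|w - u|.
  by rewrite /p opprD addrACA subrr add0r -scalerBl normrZ.
pose E := [set t : R | 0 <= t <= 1 /\ Om (p t)].
have E0 : E 0 by split; rewrite ?lexx ?ler01// /p scale0r addr0.
have hsE : has_sup E by split; [exists 0|exists 1 => t [/andP[]]].
pose T := sup E.
have T0 : 0 <= T by exact: sup_upper_bound.
have T1 : T <= 1 by apply: ge_sup; [exists 0|move=> t [/andP[]]].
exists (p T); last first.
  have -> : u = p 0 by rewrite /p scale0r addr0.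
  rewrite pB sub0r normrN ger0_norm// /p scale0r addr0 (distrC u).
  exact: ler_piMl.
apply/open_boundaryE => //; split.
  apply/closure_normP => e e0.
  have d0 : 0 < e / (`|w - u| + 1) by rewrite divr_gt0// ltr_wpDl.
  have [t Et Tt] := sup_adherent d0 hsE.
  have tT : t <= T by exact: sup_upper_bound.
  exists (p t); first by case: Et.
  rewrite pB ger0_norm ?subr_ge0//.
  have : (T - t) * (`|w - u| + 1) < e.
    by rewrite -ltr_pdivlMr ?ltr_wpDl// ltrBlDr addrC -ltrBlDr.
  by apply: le_lt_trans; rewrite ler_wpM2l ?subr_ge0// lerDl.
move=> OmT; have {T1}T1 : T < 1.
  rewrite lt_neqAle T1 andbT; apply/eqP => TE; apply: nOmw.
  by move: OmT; rewrite TE /p scale1r addrC subrK.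
have [e e0 eOm] := (open_normP Om).1 oOm _ OmT.
pose d := Num.min (1 - T) (e / (`|w - u| + 1) / 2).
have d0 : 0 < d.
  by rewrite lt_min subr_gt0 T1/= divr_gt0// divr_gt0// ltr_wpDl.
have : T + d <= T; last by lra.
apply: sup_upper_bound => //; split.
  have : d <= 1 - T by rewrite ge_min lexx.
  lra.
apply: eOm; rewrite pB opprD addrA subrr add0r normrN gtr0_norm//.
have : d * (`|w - u| + 1) <= e / 2.
  have N1 : 0 < `|w - u| + 1 by rewrite ltr_wpDl.
  rewrite -ler_pdivlMr// mulrAC.
  by rewrite ge_min lexx orbT.
have := normr_ge0 (w - u); nra.
Qed.

Section domain.
Variable Om : set X.
Hypotheses (oOm : open Om) (bOm : boundary Om !=set0) (cOm : convex_set Om).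
Local Notation d z := (norm_dist z (boundary Om)).

Lemma domain_dist_gt0 z : Om z -> 0 < d z.
Proof.
move=> Omz; have [e e0 eOm] := (open_normP Om).1 oOm _ Omz.
apply: (lt_le_trans e0); apply: le_norm_dist => // b /(open_boundaryE _ oOm).
by move=> [_ nOmb]; rewrite leNgt; apply/negP => /eOm.
Qed.

(** The boundary, not the complement, defines d; by [boundary_crossing] the two
    give the same distance. *)
Lemma ball_dist_sub z w : Om z -> `|z - w| < d z -> Om w.
Proof.
move=> Omz zw; apply: contrapT => nOmw.
have [b bb zb] := boundary_crossing oOm Omz nOmw.
by have := norm_dist_le z bb; lra.
Qed.

Lemma convex_comb u v s : 0 <= s <= 1 -> Om u -> Om v ->
  Om (s *: u + (1 - s) *: v).
Proof.
move=> /andP[s0 s1] Omu Omv.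
by have := cOm (Itv01 s0 s1) (mem_set Omu) (mem_set Omv); rewrite inE.
Qed.

(** A boundary point b closer than the claimed bound to the convex combination
    of u and v would itself be a convex combination of points of the balls of
    radii d(u) and d(v) about u and v, which lie in the set: translate u and v
    in the same direction, by lengths proportional to d(u) and d(v). *)
Lemma dist_concave u v s : 0 <= s <= 1 -> Om u -> Om v ->
  s * d u + (1 - s) * d v <= d (s *: u + (1 - s) *: v).
Proof.
move=> s01 Omu Omv; apply: le_norm_dist => // b bb.
have [_ nOmb] := (open_boundaryE b oOm).1 bb.
rewrite leNgt; apply/negP; set z := s *: u + (1 - s) *: v.
set rho := s * d u + (1 - s) * d v => zb; apply: nOmb.
have du := domain_dist_gt0 Omu; have dv := domain_dist_gt0 Omv.
have rho0 : 0 < rho by exact: le_lt_trans zb.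
pose e := rho^-1 *: (b - z).
have e1 : `|e| < 1.
  by rewrite normrZ gtr0_norm ?invr_gt0// mulrC ltr_pdivrMr// mul1r distrC.
(* The vector d(w) e is shorter than d(w), and b is the same combination of
   the translates of u and v. *)
have mv w : Om w -> Om (w + d w *: e).
  move=> Omw; apply: (ball_dist_sub Omw).
  have dw := domain_dist_gt0 Omw.
  rewrite opprD addrA subrr add0r normrN normrZ gtr0_norm//.
  by rewrite -[ltRHS]mulr1 ltr_pM2l.
have := convex_comb s01 (mv u Omu) (mv v Omv).
rewrite !scalerDr addrACA !scalerA -scalerDl -mulrDl -/rho -/z.
by rewrite divff ?gt_eqF// scale1r addrC subrK.
Qed.

End domain.
End distance_to_boundary.

(** * Sums of chords and lengths of paths *)

Section chord_sums.
Context {R : realType} {X : normedModType R}.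
Implicit Types (g : R -> X) (a b s t C : R) (l : seq R).

(** Recursive form of [path_variation], where the endpoint is not needed as a
    default value. *)
Fixpoint chord_sum g a l : R :=
  if l is b :: l' then `|g b - g a| + chord_sum g b l' else 0.

Lemma path_variationE a b g l : path_variation a b g l = chord_sum g a l.
Proof.
rewrite /path_variation; elim: l a => [a|c l IH a] /=; first by rewrite big_geq.
by rewrite big_nat_recl//= IH.
Qed.

Lemma chord_sum_ge0 g a l : 0 <= chord_sum g a l.
Proof. by elim: l a => //= b l IH a; rewrite addr_ge0. Qed.

Lemma chord_sum_rcons g a l t :
  chord_sum g a (rcons l t) = chord_sum g a l + `|g t - g (last a l)|.
Proof.
by elim: l a => [a|b l IH a] /=; [rewrite addr0 add0r|rewrite IH addrA].
Qed.

Lemma chord_sum_lip g C a l : (forall s t, `|g s - g t| <= C * `|s - t|) ->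
  path <%R a l -> chord_sum g a l <= C * (last a l - a).
Proof.
move=> gC; elim: l a => [a _|b l IH a] /=; first by rewrite subrr mulr0.
move=> /andP[ab /IH {}IH]; have := gC b a.
by rewrite (gtr0_norm (_ : 0 < b - a)) ?subr_gt0//; nra.
Qed.

(** Inserting the point t in a subdivision does not decrease its sum of chords,
    and the chords beyond t are controlled by the Lipschitz constant. *)
Lemma chord_sum_split g C a t l :
    (forall s t, `|g s - g t| <= C * `|s - t|) ->
    path <%R a l -> a <= t -> t <= last a l ->
  exists2 l', itv_partition a t l' &
    chord_sum g a l <= chord_sum g a l' + C * (last a l - t).
Proof.
move=> gC; elim: l a => [a _ at_ ta|b l IH a].
  have -> : t = a by rewrite /= in ta; lra.
  by exists [::]; [split=> /=|rewrite subrr mulr0 addr0].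
move=> pl; have := chord_sum_lip gC pl; move: pl => /= /andP[ab pl] gl at_ tl.
have [ta|ta] := leP t a.
  exists [::]; first by split=> //=; apply/eqP; lra.
  by have -> : t = a by [lra]; rewrite /= add0r.
have [tb|bt] := leP t b; last first.
  have [l' [pl' tl'] H] := IH b pl (ltW bt) tl.
  by exists (b :: l'); [split=> //=; rewrite ab|rewrite /=; lra].
exists [:: t]; first by split=> //=; rewrite ta.
have := chord_sum_lip gC pl; have := gC b t; rewrite /=.
have := ler_distD (g t) (g b) (g a).
by rewrite (ger0_norm (_ : 0 <= b - t)) ?subr_ge0//; nra.
Qed.

Lemma path_length_ge0 a b g : a <= b -> (0 <= path_length a b g)%E.
Proof.
rewrite le_eqVlt => /predU1P[<-|ab].
  apply: ereal_sup_ubound; exists [::]; first by split.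
  by rewrite path_variationE.
apply: le_ereal_sup_tmp; exists (path_variation a b g [:: b])%:E.
  by exists [:: b] => //; exact: itv_partition1.
by rewrite path_variationE lee_fin; exact: chord_sum_ge0.
Qed.

Lemma path_lengthxx a g : path_length a a g = 0%E.
Proof.
apply/eqP; rewrite eq_le path_length_ge0// andbT.
apply: ge_ereal_sup => _ [l /itv_partitionxx ->] <-.
by rewrite path_variationE.
Qed.

Lemma path_length_chord a s t g : a <= s -> s <= t ->
  (path_length a s g + `|g t - g s|%:E <= path_length a t g)%E.
Proof.
move=> as_; rewrite le_eqVlt => /predU1P[<-|st].
  by rewrite subrr normr0 adde0.
rewrite -leeBrDr//; apply: ge_ereal_sup => _ [l [pl /eqP ll] <-].
rewrite leeBrDr//; apply: ereal_sup_ubound; exists (rcons l t).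
  by split; [rewrite rcons_path pl ll|rewrite last_rcons].
by rewrite !path_variationE chord_sum_rcons ll.
Qed.

Lemma path_length_lip a s t g C : (forall s t, `|g s - g t| <= C * `|s - t|) ->
  a <= s -> s <= t ->
  (path_length a t g <= path_length a s g + (C * (t - s))%:E)%E.
Proof.
move=> gC as_ st; apply: ge_ereal_sup => _ [l [pl /eqP ll] <-].
rewrite path_variationE.
have [|l' pl'] := chord_sum_split gC pl as_; first by rewrite ll.
rewrite ll -lee_fin EFinD => /le_trans; apply; rewrite leeD2r//.
by apply: ereal_sup_ubound; exists l' => //; rewrite path_variationE.
Qed.

End chord_sums.

(** * The arc length parametrization *)

Section arclength.
Context {R : realType} {X : normedModType R}.
Variable g : R -> X.
Implicit Types (b p q s t e : R).

Lemma within_continuous_norm p q : {within `[p, q], continuous g} ->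
  forall t, p <= t <= q -> forall e, 0 < e ->
  exists2 dt : R, 0 < dt &
    forall s, p <= s <= q -> `|t - s| < dt -> `|g t - g s| < e.
Proof.
move=> /subspace_continuousP cg t tpq e e0.
have := cg t; rewrite /= in_itv/= => /(_ tpq) /cvgrPdist_lt /(_ e e0).
rewrite near_withinE => /nbhs_ballP[dt /= dt0 H]; exists dt => // s spq ts.
by apply: H; rewrite /= ?in_itv//= -ball_normE.
Qed.

Hypothesis cg : {within `[0, 1], continuous g}.
Hypothesis rg : rectifiable 0 1 g.

Definition path_len t : R := fine (path_length 0 t g).

Lemma path_lengthE t : 0 <= t <= 1 -> path_length 0 t g = (path_len t)%:E.
Proof.
move=> /andP[t0 t1]; rewrite /path_len fineK// ge0_fin_numE; last first.
  exact: path_length_ge0.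
apply: le_lt_trans rg; have := path_length_chord g t0 t1.
by apply: le_trans; rewrite leeDl// lee_fin.
Qed.

Lemma len0 : path_len 0 = 0. Proof. by rewrite /path_len path_lengthxx. Qed.

Lemma len_chord s t : 0 <= s -> s <= t -> t <= 1 ->
  path_len s + `|g t - g s| <= path_len t.
Proof.
move=> s0 st t1; have := path_length_chord g s0 st.
by rewrite !path_lengthE ?EFinD//; apply/andP; split=> //; lra.
Qed.

Lemma le_len s t : 0 <= s -> s <= t -> t <= 1 -> path_len s <= path_len t.
Proof.
move=> s0 st t1; have := len_chord s0 st t1.
by have := normr_ge0 (g t - g s); lra.
Qed.

Lemma len_ge0 t : 0 <= t <= 1 -> 0 <= path_len t.
Proof. by move=> /andP[t0 t1]; rewrite -len0; exact: le_len. Qed.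

Lemma arclength_param_fiber b s : b <= 1 ->
  [set t | t \in `[0, b] /\ (s%:E <= path_length 0 t g)%E] =
  [set t | 0 <= t <= b /\ s <= path_len t].
Proof.
move=> b1; apply/seteqP; split=> t /=; rewrite in_itv/= => -[tb].
  by rewrite path_lengthE ?lee_fin//; lra.
by rewrite path_lengthE ?lee_fin//; lra.
Qed.

(** The infimum in [arclength_param] for the piece of the path over [0, b]. *)
Definition arctime b s : R := inf [set t | 0 <= t <= b /\ s <= path_len t].

Lemma arclength_paramE b s : b <= 1 ->
  arclength_param 0 b g s = g (arctime b s).
Proof. by move=> b1; rewrite /arclength_param arclength_param_fiber. Qed.

Lemma arctime_le b s t : 0 <= t <= b -> s <= path_len t -> arctime b s <= t.
Proof. by move=> tb st; apply: ge_inf => //; exists 0 => u [/andP[]]. Qed.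

Lemma arctime_ge b s t : 0 <= b <= 1 ->
  s <= path_len b ->
  (forall u, 0 <= u <= b -> s <= path_len u -> t <= u) -> t <= arctime b s.
Proof.
move=> b01 sb H; apply: lb_le_inf; last by move=> u [ub us]; exact: H.
by exists b; split=> //; case/andP: b01 => -> _; rewrite lexx.
Qed.

Lemma arctime_itv b s : 0 <= b <= 1 ->
  s <= path_len b -> 0 <= arctime b s <= b.
Proof.
move=> b01 sb; apply/andP; split; last first.
  by apply: arctime_le => //; rewrite lexx andbT; case/andP: b01.
by apply: arctime_ge => // u /andP[].
Qed.

Lemma len_arctime_gt b s t : 0 <= b <= 1 ->
  s <= path_len b -> 0 <= t <= b -> arctime b s < t ->
  s <= path_len t.
Proof.
move=> b01 sb tb st; rewrite leNgt; apply/negP => ts.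
suff : t <= arctime b s by lra.
apply: arctime_ge => // u ub su; rewrite leNgt; apply/negP => ut.
have : path_len u <= path_len t by apply: le_len; lra.
by lra.
Qed.

Lemma len_arctime_lt b s t : 0 <= t <= b -> t < arctime b s -> path_len t < s.
Proof.
by move=> tb ts; rewrite ltNge; apply/negP => /(arctime_le tb); lra.
Qed.

(** Parameters slightly after the first arc time and slightly before the second
    have lengths between s1 and s2, and their images approach the two endpoints
    by continuity of g. *)
Lemma arctime_lip b s1 s2 : 0 <= b <= 1 ->
  s1 <= s2 -> s2 <= path_len b ->
  `|g (arctime b s2) - g (arctime b s1)| <= s2 - s1.
Proof.
move=> b01 s12 s2b; have s1b := le_trans s12 s2b.
have := arctime_itv b01 s1b; have := arctime_itv b01 s2b.
have L1 u := @len_arctime_gt b s1 u b01 s1b.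
have L2 u := @len_arctime_lt b s2 u.
have : arctime b s1 <= arctime b s2.
  by apply: arctime_ge => // u ub su; apply: arctime_le => //; lra.
move: (arctime b s1) (arctime b s2) L1 L2 => t1 t2 L1 L2.
rewrite le_eqVlt => /predU1P[-> _ _|t12 t2b t1b].
  by rewrite subrr normr0 subr_ge0.
apply/ler_addgt0Pr => e e0.
have e2 : 0 < e / 2 by lra.
have t1u : 0 <= t1 <= 1 by lra.
have t2u : 0 <= t2 <= 1 by lra.
have [d1 d10 H1] := within_continuous_norm cg t1u e2.
have [d2 d20 H2] := within_continuous_norm cg t2u e2.
pose m := (t1 + t2) / 2.
(* Both auxiliary parameters are kept on their own side of the midpoint m. *)
have [u1 [u1t u1m u1d]] : exists u, [/\ t1 < u, u <= m & u < t1 + d1].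
  exists (Num.min m (t1 + d1 / 2)); rewrite /m; split.
  - by rewrite lt_min; lra.
  - by rewrite ge_min lexx.
  - by rewrite gt_min; apply/orP; right; lra.
have [u2 [u2t u2m u2d]] : exists u, [/\ u < t2, m <= u & t2 - d2 < u].
  exists (Num.max m (t2 - d2 / 2)); rewrite /m; split.
  - by rewrite gt_max; lra.
  - by rewrite le_max lexx.
  - by rewrite lt_max; apply/orP; right; lra.
have su1 : s1 <= path_len u1 by apply: L1 => //; lra.
have su2 : path_len u2 < s2 by apply: L2 => //; lra.
have B : path_len u1 + `|g u2 - g u1| <= path_len u2 by apply: len_chord; lra.
have B1 : `|g t1 - g u1| < e / 2.
  by apply: H1; [lra|rewrite ltr0_norm ?subr_lt0//; lra].
have B2 : `|g t2 - g u2| < e / 2.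
  by apply: H2; [lra|rewrite gtr0_norm ?subr_gt0//; lra].
have := ler_distD (g u2) (g t2) (g t1).
have := ler_distD (g u1) (g u2) (g t1).
by rewrite (distrC (g u1) (g t1)); lra.
Qed.

(** The path may stop: the arc time of the length at t can precede t, but then
    the path has length zero, hence is constant, in between. *)
Lemma arctime_len b t : 0 <= b <= 1 ->
  0 <= t <= b -> g (arctime b (path_len t)) = g t.
Proof.
move=> b01 tb; have lb : path_len t <= path_len b by apply: le_len; lra.
have := arctime_itv b01 lb.
have L1 u := @len_arctime_gt b (path_len t) u b01 lb.
have : arctime b (path_len t) <= t by exact: arctime_le.
move: (arctime b (path_len t)) L1 => t1 L1.
rewrite le_eqVlt => /predU1P[->//|t1t t1b].
apply/eqP; rewrite -subr_eq0 -normr_le0; apply/ler_addgt0Pr => e e0.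
have t1u : 0 <= t1 <= 1 by lra.
have [d1 d10 H1] := within_continuous_norm cg t1u e0.
have [u [ut um ud]] : exists u, [/\ t1 < u, u <= t & u < t1 + d1].
  exists (Num.min t (t1 + d1 / 2)); split.
  - by rewrite lt_min; lra.
  - by rewrite ge_min lexx.
  - by rewrite gt_min; apply/orP; right; lra.
have su : path_len t <= path_len u by apply: L1 => //; lra.
have B : path_len u + `|g t - g u| <= path_len t by apply: len_chord; lra.
have B1 : `|g t1 - g u| < e.
  by apply: H1; [lra|rewrite ltr0_norm ?subr_lt0//; lra].
have := ler_distD (g u) (g t1) (g t).
by rewrite (distrC (g u) (g t)); lra.
Qed.

Lemma arctime_between b p q s : 0 <= b <= 1 ->
  0 <= p -> p <= q -> q <= b ->
  path_len p <= s <= path_len q ->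
  exists2 c, p <= c <= q & g (arctime b s) = g c.
Proof.
move=> b01 p0 pq qb /andP[]; rewrite le_eqVlt => /predU1P[<- _|ps sq].
  by exists p; [lra|apply: arctime_len; lra].
exists (arctime b s) => //; apply/andP; split; last by apply: arctime_le; lra.
have sb : s <= path_len b by apply: (le_trans sq); apply: le_len; lra.
apply: arctime_ge => // u ub su; rewrite leNgt; apply/negP => up.
have : path_len u <= path_len p by apply: le_len; lra.
by lra.
Qed.

(** So one arc length curve serves for all the initial pieces of a path. *)
Lemma arctime_restrict b s : 0 <= b <= 1 -> s <= path_len b ->
  arctime b s = arctime 1 s.
Proof.
move=> b01 sb; have u1 : 0 <= (1 : R) <= 1 by rewrite ler01 lexx.
have s1 : s <= path_len 1 by apply: (le_trans sb); apply: le_len; lra.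
apply/eqP; rewrite eq_le; apply/andP; split.
  apply: arctime_ge => // u uu su; have [ub|bu] := leP u b.
    by apply: arctime_le => //; lra.
  by apply: (@le_trans _ _ b); [apply: arctime_le => //; lra|exact: ltW].
by apply: arctime_ge => // u uu su; apply: arctime_le => //; lra.
Qed.

End arclength.

(** * Lipschitz curves and their quasihyperbolic length *)

Section lipschitz_curves.
Context {R : realType} {X : normedModType R}.
Implicit Types (g : R -> X) (a b p q s t C L : R).

(** A property of segments that holds around every point and passes to
    concatenations holds globally; this is compactness of the segment in the
    form suited to additive quantities such as lengths and integrals. *)
Lemma cousin (P : R -> R -> Prop) a b : a <= b ->
    (forall p q t, a <= p -> p <= q -> q <= t -> t <= b ->
      P p q -> P q t -> P p t) ->
    (forall c, a <= c <= b -> exists2 dt : R, 0 < dt &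
      forall p q, a <= p -> p <= c -> c <= q -> q <= b ->
        c - p < dt -> q - c < dt -> P p q) ->
  P a b.
Proof.
move=> ab Ptrans Ploc; pose E := [set t | a <= t <= b /\ P a t].
have Ea : E a.
  split; first by rewrite lexx.
  have [|dt dt0] := Ploc a; first by rewrite lexx.
  by apply; rewrite ?subrr.
have hsE : has_sup E by split; [exists a|exists b => t [/andP[]]].
have aT : a <= sup E by exact: sup_upper_bound.
have Tb : sup E <= b by apply: ge_sup; [exists a|move=> t [/andP[]]].
have TE t : E t -> t <= sup E by move=> Et; exact: sup_upper_bound.
have [|dt dt0 H] := Ploc (sup E); first by rewrite aT.
have [t Et Tt] := sup_adherent dt0 hsE; have tT := TE t Et.
move: (sup E) aT Tb TE H Tt tT => T aT Tb TE H Tt tT.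
have [at_ tb] : a <= t /\ t <= b by case: Et => /andP[].
have Pn q : T <= q -> q <= b -> q - T < dt -> P a q.
  move=> Tq qb qT; apply: (Ptrans a t q) => //; [lra|by case: Et|].
  by apply: H => //; lra.
have [bT|Tb'] := leP b T; first by apply: Pn; lra.
have [bd|db] := ltP (b - T) dt; first by apply: Pn; lra.
have : T + dt / 2 <= T; last by lra.
by apply: TE; split; [lra|apply: Pn; lra].
Qed.

Definition lipschitz_curve C g := forall p q, `|g p - g q| <= C * `|p - q|.

Lemma lipschitz_curve_homo C g :
  (forall p q, p <= q -> `|g q - g p| <= C * (q - p)) -> lipschitz_curve C g.
Proof.
move=> gC p q; have [pq|/ltW qp] := leP p q.
  by rewrite distrC (distrC p) (ger0_norm (_ : 0 <= q - p)) ?subr_ge0// gC.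
by rewrite (ger0_norm (_ : 0 <= p - q)) ?subr_ge0// gC.
Qed.

Lemma lipschitz_curve_ge0 C g : lipschitz_curve C g -> 0 <= C.
Proof.
move=> /(_ 1 0); rewrite subr0 normr1 mulr1.
exact: le_trans.
Qed.

Lemma lipschitz_curve_continuous C g : lipschitz_curve C g -> continuous g.
Proof.
move=> gC p; have C0 := lipschitz_curve_ge0 gC.
apply/cvgrPdist_lt => e e0; apply/nbhs_ballP.
exists (e / (C + 1)) => /=; first by rewrite divr_gt0// ltr_wpDl.
move=> q; rewrite /ball_/= ltr_pdivlMr ?ltr_wpDl// => pq.
apply: le_lt_trans (gC p q) _; apply: le_lt_trans pq.
by rewrite mulrC ler_wpM2l// lerDl.
Qed.

(** Curves are extended from [0, L] to the line by constants, so that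
    everything below can be stated for globally Lipschitz curves. *)
Definition clamp L s : R := Num.max 0 (Num.min s L).

Lemma clamp_itv L s : 0 <= L -> 0 <= clamp L s <= L.
Proof.
by move=> L0; rewrite /clamp le_max lexx/= ge_max L0 ge_min lexx orbT.
Qed.

Lemma clamp_id L s : 0 <= s <= L -> clamp L s = s.
Proof. by move=> /andP[s0 sL]; rewrite /clamp min_l// max_r. Qed.

Lemma clamp_le L s t : 0 <= L -> s <= t ->
  0 <= clamp L t - clamp L s <= t - s.
Proof.
move=> L0 st; rewrite /clamp.
have [sL|sL] := leP s L; have [tL|tL] := leP t L; rewrite ?(max_r L0).
- by have [s0|s0] := leP 0 s; have [t0|t0] := leP 0 t; lra.
- by have [s0|s0] := leP 0 s; lra.
- by have [t0|t0] := leP 0 t; lra.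
- by lra.
Qed.

End lipschitz_curves.

Section quasihyperbolic_length.
Context {R : realType} {X : normedModType R}.
Variable Om : set X.
Hypotheses (oOm : open Om) (bOm : boundary Om !=set0).
Implicit Types (g : R -> X) (a b p q s t C L : R).
Local Notation d z := (norm_dist z (boundary Om)).

Lemma density_continuous C g : lipschitz_curve C g -> (forall t, Om (g t)) ->
  continuous (fun t => (d (g t))^-1).
Proof.
move=> gC Omg t; apply: cvgV; first exact/lt0r_neq0/domain_dist_gt0.
suff dC : @lipschitz_curve R R^o C (fun t => d (g t)).
  exact: lipschitz_curve_continuous dC t.
move=> p q.
have := norm_dist_lip (g p) (g q) bOm; have := norm_dist_lip (g q) (g p) bOm.
rewrite (distrC (g q)) => H1 H2; apply: le_trans (gC p q).
by rewrite ler_norml; lra.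
Qed.

Definition arc_curve g s : X := g (arctime g 1 (clamp (path_len g 1) s)).

Section arc.
Variable g : R -> X.
Hypotheses (pg : path_in Om g) (rg : rectifiable 0 1 g).
Let cg : {within `[0, 1], continuous g}. Proof. by case: pg. Qed.
Let u1 : 0 <= (1 : R) <= 1. Proof. by rewrite ler01 lexx. Qed.
Let L0 : 0 <= path_len g 1. Proof. exact: len_ge0. Qed.

Lemma arc_lip : lipschitz_curve 1 (arc_curve g).
Proof.
apply: lipschitz_curve_homo => p q pq; rewrite mul1r.
have /andP[pq0 pq1] := clamp_le L0 pq.
have /andP[_ qL] := clamp_itv q L0.
apply: le_trans pq1; apply: arctime_lip => //.
by rewrite -subr_ge0.
Qed.

Lemma arc_in s : Om (arc_curve g s).
Proof.
case: pg => _ gOm; apply: gOm; rewrite in_itv/=; apply: arctime_itv => //.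
by case/andP: (clamp_itv s L0).
Qed.

Lemma arc_len t : 0 <= t <= 1 -> arc_curve g (path_len g t) = g t.
Proof.
move=> t01; rewrite /arc_curve clamp_id; first exact: arctime_len.
by case/andP: (t01) => t0 t1; rewrite len_ge0//= le_len.
Qed.

Lemma arc_between p q s : 0 <= p -> p <= q -> q <= 1 ->
  path_len g p <= s <= path_len g q ->
  exists2 c, p <= c <= q & arc_curve g s = g c.
Proof.
move=> p0 pq q1 /[dup] /andP[ps sq] /(arctime_between cg rg u1 p0 pq q1) H.
rewrite /arc_curve clamp_id//; apply/andP; split.
  by apply: le_trans ps; apply: len_ge0 => //; lra.
by apply: (le_trans sq); apply: le_len => //; lra.
Qed.

Lemma arc_density_continuous : continuous (fun s => (d (arc_curve g s))^-1).
Proof. exact: density_continuous arc_lip arc_in. Qed.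

Lemma qh_lengthE b : 0 <= b <= 1 ->
  qh_length Om 0 b g =
  (itv_int (fun s => (d (arc_curve g s))^-1) 0 (path_len g b))%:E.
Proof.
move=> b01; rewrite /qh_length /line_integral -itv_intE; last first.
  exact: arc_density_continuous.
apply: eq_integral => s; rewrite inE/= in_itv/= => /andP[s0 sb].
have b1 : b <= 1 by case/andP: b01.
have s1 : s <= path_len g 1 by apply: (le_trans sb); apply: le_len => //; lra.
by rewrite arclength_paramE// arctime_restrict// /arc_curve clamp_id// s0.
Qed.

End arc.

(** Both sides are additive in the parameter segment, and on a short segment
    around c both densities are close to the density at c while the length
    grows by at most C times the parameter; [cousin] globalizes, with an error
    e per unit of parameter. *)
Lemma qh_length_lip C g : lipschitz_curve C g -> (forall t, Om (g t)) ->
  rectifiable 0 1 g /\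
  (qh_length Om 0 1 g <= (C * itv_int (fun t => (d (g t))^-1) 0 1)%:E)%E.
Proof.
move=> gC Omg; have C0 := lipschitz_curve_ge0 gC.
have rg : rectifiable 0 1 g.
  have := path_length_lip gC (lexx 0) ler01.
  by rewrite path_lengthxx add0e => /le_lt_trans; apply; rewrite ltry.
have pg : path_in Om g.
  split=> [|t _]; last exact: Omg.
  exact/continuous_subspaceT/(lipschitz_curve_continuous gC).
split=> //; rewrite qh_lengthE ?ler01 ?lexx// lee_fin.
set h := fun t : R => (d (g t))^-1.
set k := fun s : R => (d (arc_curve g s))^-1.
have ch : continuous h := density_continuous gC Omg.
have ck : continuous k := arc_density_continuous pg rg.
have h0 t : 0 < h t by rewrite invr_gt0; exact: domain_dist_gt0.
have lenC p q : 0 <= p -> p <= q -> q <= 1 ->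
    0 <= path_len g q - path_len g p <= C * (q - p).
  move=> p0 pq q1; rewrite subr_ge0 le_len//=.
  have := path_length_lip gC p0 pq.
  by rewrite !path_lengthE// -?EFinD ?lee_fin; lra.
apply/ler_addgt0Pr => e e0.
pose P p q := itv_int k (path_len g p) (path_len g q) <=
  C * itv_int h p q + e * (q - p).
suff : P 0 1 by rewrite /P len0 subr0 mulr1.
apply: (@cousin R P) => [|p q t p0 pq qt t1 P1 P2|c c01]; first exact: ler01.
  have lpq : path_len g p <= path_len g q by apply: le_len => //; lra.
  have lqt : path_len g q <= path_len g t by apply: le_len => //; lra.
  rewrite /P (itv_int_split ch pq qt) (itv_int_split ck lpq lqt).
  apply: (le_trans (lerD P1 P2)); rewrite le_eqVlt; apply/orP; left.
  by apply/eqP; ring.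
(* The two errors eta add up to 2 eta C <= e; the summand 1 covers C = 0. *)
pose eta := e / (2 * (C + 1)).
have eta0 : 0 < eta by rewrite divr_gt0// mulr_gt0// ltr_wpDl.
have etaE : eta * (2 * (C + 1)) = e.
  by rewrite divfK// gt_eqF// mulr_gt0// ltr_wpDl.
have := ch c => /cvgrPdist_lt /(_ eta eta0) /nbhs_ballP[dt /= dt0 H].
exists dt => // p q p0 pc cq q1 cp qc; rewrite /P.
(* On [p, q] the density stays within eta of its value at c. *)
have hc t : p <= t <= q -> h c - eta <= h t <= h c + eta.
  move=> tpq; have : `|h c - h t| < eta.
    by apply: H; rewrite -ball_normE/= ltr_norml; lra.
  by rewrite ltr_norml; lra.
have pq : p <= q by lra.
have /andP[l0 lC] := lenC p q p0 pq q1.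
have lpq : path_len g p <= path_len g q by rewrite -subr_ge0.
have U : itv_int k (path_len g p) (path_len g q) <=
    (h c + eta) * (path_len g q - path_len g p).
  apply: itv_int_ub => // s spq.
  have [u upq sE] := arc_between pg rg p0 pq q1 spq.
  by have := hc u upq; rewrite /h /k sE; lra.
have B : (h c - eta) * (q - p) <= itv_int h p q.
  by apply: itv_int_lb => // s spq; have := hc s spq; lra.
have hcp := h0 c.
have U2 : (h c + eta) * (path_len g q - path_len g p) <=
    (h c + eta) * (C * (q - p)).
  by rewrite ler_wpM2l//; lra.
have B2 : C * ((h c - eta) * (q - p)) <= C * itv_int h p q by rewrite ler_wpM2l.
have D : eta * (2 * C) * (q - p) <= e * (q - p).
  by rewrite ler_wpM2r ?subr_ge0// -etaE ler_wpM2l//; lra.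
by lra.
Qed.

End quasihyperbolic_length.

(** * The quasihyperbolic distance *)

Section quasihyperbolic_distance.
Context {R : realType} {X : normedModType R}.
Variable Om : set X.
Hypotheses (oOm : open Om) (bOm : boundary Om !=set0) (cOm : convex_set Om).
Implicit Types (g : R -> X) (u v w x y z : X) (a b p q s t e m C L : R).
Local Notation d z := (norm_dist z (boundary Om)).
Local Notation k := (qh_dist Om).
Local Notation qh_inf u v :=
  (ereal_inf [set qh_length Om 0 1 h | h in joining Om u v]).

Lemma qh_length_ge0 a b g : (0 <= qh_length Om a b g)%E.
Proof.
apply: integral_ge0 => s _; rewrite lee_fin invr_ge0.
exact: le_norm_dist.
Qed.

Lemma qh_dist_ge0 u v : 0 <= k u v.
Proof.
apply: fine_ge0; apply: le_ereal_inf_tmp => _ [g _ <-]; exact: qh_length_ge0.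
Qed.

Lemma qh_inf_le C g : lipschitz_curve C g -> (forall t, Om (g t)) ->
  (qh_inf (g 0%R) (g 1%R) <=
   (C * itv_int (fun t => (d (g t))^-1) 0 1)%:E)%E.
Proof.
move=> gC Omg; have [rg lg] := qh_length_lip oOm bOm gC Omg.
apply: ge_ereal_inf; exists (qh_length Om 0 1 g) => //; exists g => //.
split=> //; split=> [|t _]; last exact: Omg.
exact/continuous_subspaceT/(lipschitz_curve_continuous gC).
Qed.

Lemma qh_dist_le01 C g : lipschitz_curve C g -> (forall t, Om (g t)) ->
  k (g 0) (g 1) <= C * itv_int (fun t => (d (g t))^-1) 0 1.
Proof.
move=> gC Omg; have := qh_inf_le gC Omg; rewrite /qh_dist.
have : (0 <= qh_inf (g 0%R) (g 1%R))%E.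
  by apply: le_ereal_inf_tmp => _ [h _ <-]; exact: qh_length_ge0.
by case: ereal_inf => //= r _; rewrite lee_fin.
Qed.

Lemma density_int_ge0 g a b : (forall t, Om (g t)) ->
  0 <= itv_int (fun t => (d (g t))^-1) a b.
Proof.
by move=> Omg; apply: itv_int_ge0 => t _; rewrite invr_ge0; exact: le_norm_dist.
Qed.

(** Rescaling the parameter reduces this to [qh_length_lip] on [0, 1]. *)
Lemma qh_dist_le C g a b : a <= b -> lipschitz_curve C g ->
  (forall t, Om (g t)) ->
  k (g a) (g b) <= C * itv_int (fun t => (d (g t))^-1) a b.
Proof.
rewrite le_eqVlt => /predU1P[<-|ab] gC Omg.
  have c0 : lipschitz_curve 0 (cst (g a)).
    by move=> p q; rewrite subrr normr0 mul0r.
  have := qh_dist_le01 c0 (fun=> Omg a); rewrite mul0r => /le_trans; apply.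
  by rewrite mulr_ge0 ?(lipschitz_curve_ge0 gC)// density_int_ge0.
have ba : 0 < b - a by rewrite subr_gt0.
pose h t := g ((b - a) * t + a).
have hC : lipschitz_curve (C * (b - a)) h.
  move=> p q; apply: le_trans (gC _ _) _.
  rewrite opprD addrACA subrr addr0 -mulrBr normrM (gtr0_norm ba) mulrA.
  exact: lexx.
have := qh_dist_le01 hC (fun t => Omg _).
rewrite /h mulr0 add0r mulr1 subrK -mulrA.
rewrite -(@itv_int_affine _ (fun t => (d (g t))^-1) 0 1 a (b - a))//.
  by rewrite mulr0 add0r mulr1 subrK.
exact: density_continuous gC Omg.
Qed.

Lemma segment_in u v t : 0 <= t <= 1 -> Om u -> Om v -> Om (u + t *: (v - u)).
Proof.
move=> t01 Omu Omv; have := convex_comb cOm t01 Omv Omu.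
by rewrite scalerBl scale1r scalerBr addrCA addrA.
Qed.

Definition segment u v t : X := u + clamp 1 t *: (v - u).

Lemma segment_lip u v : lipschitz_curve `|v - u| (segment u v).
Proof.
apply: lipschitz_curve_homo => p q pq; have /andP[c0 c1] := clamp_le ler01 pq.
rewrite /segment opprD addrACA subrr add0r -scalerBl normrZ mulrC.
by rewrite ger0_norm// ler_wpM2l.
Qed.

Lemma segment_Om u v t : Om u -> Om v -> Om (segment u v t).
Proof.
by move=> Omu Omv; apply: segment_in => //; apply: clamp_itv; exact: ler01.
Qed.

Lemma segment0 u v : segment u v 0 = u.
Proof. by rewrite /segment clamp_id ?lexx ?ler01// scale0r addr0. Qed.

Lemma segment1 u v : segment u v 1 = v.
Proof. by rewrite /segment clamp_id ?lexx ?ler01// scale1r addrC subrK. Qed.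

Lemma qh_dist_segment u v m : Om u -> Om v -> 0 < m ->
  (forall t, 0 <= t <= 1 -> m <= d (u + t *: (v - u))) ->
  k u v <= `|v - u| / m.
Proof.
move=> Omu Omv m0 md; have Oms t := segment_Om t Omu Omv.
have := qh_dist_le ler01 (@segment_lip u v) Oms.
rewrite segment0 segment1 => /le_trans; apply; rewrite ler_wpM2l//.
have -> : m^-1 = m^-1 * (1 - 0) by rewrite subr0 mulr1.
apply: itv_int_ub => [||t t01].
- exact: density_continuous (@segment_lip u v) Oms.
- exact: ler01.
- rewrite lef_pV2 ?posrE//; last exact: domain_dist_gt0.
  by rewrite /segment clamp_id//; exact: md.
Qed.

(** The infimum is finite because segments join points of a convex set; the
    curve is the arc length curve of a nearly minimal path. *)
Lemma qh_dist_approx u v e : Om u -> Om v -> 0 < e ->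
  exists L g, [/\ 0 <= L, lipschitz_curve 1 g, forall t, Om (g t), g 0 = u
    & g L = v] /\ itv_int (fun t => (d (g t))^-1) 0 L < k u v + e.
Proof.
move=> Omu Omv e0.
have := qh_inf_le (@segment_lip u v) (fun t => segment_Om t Omu Omv).
rewrite segment0 segment1 /qh_dist.
set S := [set qh_length Om 0 1 h | h in joining Om u v] => Sle.
have S0 : (0 <= ereal_inf S)%E.
  by apply: le_ereal_inf_tmp => _ [h _ <-]; exact: qh_length_ge0.
have Sfin : ereal_inf S \is a fin_num.
  by rewrite ge0_fin_numE//; apply: le_lt_trans Sle _; rewrite ltry.
have [_ [g [pg rg g0 g1] <-] lg] := lb_ereal_inf_adherent e0 Sfin.
have u0 : 0 <= (0 : R) <= 1 by rewrite lexx ler01.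
have u1 : 0 <= (1 : R) <= 1 by rewrite lexx ler01.
exists (path_len g 1), (arc_curve g); split.
  split; first exact: len_ge0.
  - exact: arc_lip pg rg.
  - exact: arc_in pg rg.
  - by rewrite -(len0 g) (arc_len pg rg).
  - by rewrite (arc_len pg rg).
rewrite -lte_fin EFinD (fineK Sfin); move: lg.
by rewrite (qh_lengthE oOm bOm pg rg u1).
Qed.

(** A curve of length L from u to v satisfies d <= d(v) + l at length l before
    its end, so [itv_int_inv_lb] applies, and L is at
    least the norm of u - v. *)
Lemma qh_dist_ln_lb u v : Om u -> Om v ->
  ln (1 + `|u - v| / d v) <= k u v.
Proof.
move=> Omu Omv; apply/ler_addgt0Pr => e e0.
have [L [g [[L0 gL Omg g0 g1] lg]]] := qh_dist_approx Omu Omv e0.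
apply: le_trans (ltW lg); have dv := domain_dist_gt0 oOm bOm Omv.
have uvL : `|u - v| <= L.
  rewrite -g0 -g1; apply: le_trans (gL _ _) _.
  by rewrite mul1r sub0r normrN ger0_norm.
apply: (@le_trans _ _ (ln (1 + L / d v))).
  rewrite ler_ln ?posrE ?lerD2l ?ler_pM2r ?invr_gt0//.
    by rewrite ltr_wpDr// divr_ge0// ltW.
  by rewrite ltr_wpDr// divr_ge0// ltW.
apply: itv_int_inv_lb => //; first exact: density_continuous gL Omg.
move=> t /andP[t0 tL]; rewrite lef_pV2 ?posrE; last 2 first.
- by rewrite ltr_wpDr// subr_ge0.
- exact: domain_dist_gt0.
apply: le_trans (norm_dist_lip (g t) v bOm) _; rewrite lerD2l -g1.
apply: le_trans (gL _ _) _.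
by rewrite mul1r distrC ger0_norm ?subr_ge0.
Qed.

Lemma qh_dist_triangle u v w : Om u -> Om v -> Om w ->
  k u w <= k u v + k v w.
Proof.
move=> Omu Omv Omw; apply/ler_addgt0Pr => e e0.
have e2 : 0 < e / 2 by rewrite divr_gt0.
have [L [g [[L0 gL Omg g0 g1] lg]]] := qh_dist_approx Omu Omv e2.
have [M [h [[M0 hL Omh h0 h1] lh]]] := qh_dist_approx Omv Omw e2.
(* The factor 1 matches the affine reparametrization of [itv_int_affine]. *)
pose c t := if t <= L then g t else h (1 * t - L).
have cE t : L <= t -> c t = h (1 * t - L).
  rewrite /c le_eqVlt => /predU1P[<-|Lt].
    by rewrite lexx mul1r subrr g1 h0.
  by rewrite leNgt Lt.
have cE' t : t <= L -> c t = g t by move=> tL; rewrite /c tL.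
have cC : lipschitz_curve 1 c.
  have gl p q : p <= q -> `|g q - g p| <= q - p.
    by move=> pq; apply: le_trans (gL _ _) _; rewrite mul1r ger0_norm ?subr_ge0.
  have hl p q : p <= q -> `|h (1 * q - L) - h (1 * p - L)| <= q - p.
    move=> pq; apply: le_trans (hL _ _) _.
    by rewrite !mul1r opprB addrA subrK ger0_norm ?subr_ge0.
  apply: lipschitz_curve_homo => p q pq; rewrite mul1r.
  have [qL|/ltW Lq] := leP q L.
    by rewrite !cE'//; [exact: gl|exact: le_trans qL].
  have [Lp|/ltW pL] := leP L p; first by rewrite !cE//; exact: hl.
  have := gl _ _ pL; have := hl _ _ Lq.
  rewrite -(cE' L)// -(cE' p)// -(cE L)// -(cE q)//.
  by have := ler_distD (c L) (c q) (c p); lra.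
have Omc t : Om (c t) by rewrite /c; case: ifP.
have LM : 0 <= L + M by rewrite addr_ge0.
have := qh_dist_le LM cC Omc.
rewrite mul1r cE'// g0 cE ?lerDl// mul1r addrAC subrr add0r h1.
have cont := density_continuous oOm bOm cC Omc.
rewrite (@itv_int_split _ _ 0 L) ?lerDl//.
have -> : itv_int (fun t => (d (c t))^-1) 0 L =
          itv_int (fun t => (d (g t))^-1) 0 L.
  by apply: eq_itv_int => t /andP[_ tL]; rewrite cE'.
have -> : itv_int (fun t => (d (c t))^-1) L (L + M) =
          itv_int (fun t => (d (h t))^-1) 0 M.
  transitivity (itv_int (fun t => (d (h (1 * t - L)))^-1) L (L + M)).
    by apply: eq_itv_int => t /andP[Lt _]; rewrite cE.
  rewrite -[LHS]mul1r.
  rewrite -(@itv_int_affine _ (fun t => (d (h t))^-1) L (L + M) (- L) 1)//.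
  - by rewrite !mul1r subrr addrAC subrr add0r.
  - exact: density_continuous hL Omh.
  - by rewrite lerDl.
by lra.
Qed.

(** Here D is the value of d at a point, D0 the one at the center x0, and
    D' the one at the image of the point under the contraction of ratio s
    towards x0; the hypothesis is the concavity of d. *)
Lemma scaled_density_gap s (D D' D0 : R) : 0 < s -> s < 1 -> 0 < D -> 0 < D0 ->
  s * D + (1 - s) * D0 <= D' ->
  s / D' <= D^-1 /\ (D <= 2 * D0 -> s / D' + (1 - s) / (4 * D0) <= D^-1).
Proof.
move=> s0 s1 Dp D0p DD'; set E := s * D + (1 - s) * D0 in DD' *.
have r0 : 0 < 1 - s by rewrite subr_gt0.
have E0 : 0 < E by rewrite addr_gt0// mulr_gt0.
have sE : s / D' <= s / E.
  by rewrite ler_wpM2l ?(ltW s0)// lef_pV2 ?posrE//; exact: lt_le_trans DD'.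
have gap : D^-1 - s / E = (1 - s) * (D0 / (D * E)).
  by rewrite /E; field; rewrite -/E; apply/andP; split; exact: lt0r_neq0.
split=> [|D2].
  apply: (le_trans sE); rewrite -subr_ge0 gap.
  by rewrite mulr_ge0 ?ltW// divr_gt0// mulr_gt0.
have E2 : E <= 2 * D0.
  have : s * D <= s * (2 * D0) by rewrite ler_wpM2l// ltW.
  have : 0 <= (1 - s) * D0 by rewrite mulr_ge0// ltW.
  by rewrite /E; lra.
have DE : D * E <= 4 * D0 * D0.
  have : D * E <= (2 * D0) * (2 * D0) by apply: ler_pM => //; exact: ltW.
  by lra.
have : (1 - s) / (4 * D0) <= (1 - s) * (D0 / (D * E)).
  rewrite ler_pM2l// ler_pdivlMr ?mulr_gt0// mulrC ler_pdivrMr ?mulr_gt0//.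
  by lra.
by rewrite -gap; lra.
Qed.

(** By [scaled_density_gap] contracting a curve towards x0 does not increase
    its element of quasihyperbolic length, and decreases it by at least m per
    unit of length as long as d <= 2 d(x0), that is, at least on the initial
    piece of length l. The gain m l does not depend on the curve, so it
    survives in the infimum. *)
Lemma qh_dist_shrink x0 y s : Om x0 -> Om y -> x0 != y -> 0 < s -> s < 1 ->
  k x0 (s *: y + (1 - s) *: x0) < k x0 y.
Proof.
move=> Om0 Omy x0y s0 s1; pose l := Num.min `|y - x0| (d x0).
have d0 : 0 < d x0 by exact: domain_dist_gt0.
have r0 : 0 < 1 - s by rewrite subr_gt0.
have l0 : 0 < l by rewrite lt_min d0 normr_gt0 subr_eq0 eq_sym x0y.
pose m := (1 - s) / (4 * d x0).
have m0 : 0 < m by rewrite divr_gt0// mulr_gt0.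
have [L [g [[L0 gL Omg g0 g1] lg]]] := qh_dist_approx Om0 Omy (mulr_gt0 m0 l0).
have lL : l <= L.
  rewrite /l ge_min; apply/orP; left; rewrite -g0 -g1.
  by apply: le_trans (gL _ _) _; rewrite mul1r subr0 ger0_norm.
have s01 : 0 <= s <= 1 by rewrite !ltW.
pose h t := s *: g t + (1 - s) *: x0.
have Omh t : Om (h t) by exact: convex_comb.
have hC : lipschitz_curve s h.
  move=> p q; rewrite /h opprD addrACA subrr addr0 -scalerBr normrZ gtr0_norm//.
  by rewrite ler_pM2l//; apply: le_trans (gL _ _) _; rewrite mul1r.
have := qh_dist_le L0 hC Omh.
rewrite {1 2}/h g0 g1 -scalerDl addrC subrK scale1r => /le_lt_trans; apply.
set f := fun t => (d (h t))^-1.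
set f' := fun t => (d (g t))^-1.
have cf : continuous f := density_continuous oOm bOm hC Omh.
have cf' : continuous f' := density_continuous oOm bOm gL Omg.
have gap t := scaled_density_gap s0 s1 (domain_dist_gt0 oOm bOm (Omg t)) d0
  (dist_concave oOm bOm cOm s01 (Omg t) Om0).
have caff c : continuous (fun t => s * f t + c).
  move=> t; apply: cvgD; last exact: cvg_cst.
  by apply: cvgM; [exact: cvg_cst|exact: cf].
have I1 : s * itv_int f 0 l + m * (l - 0) <= itv_int f' 0 l.
  rewrite -itv_int_axpb//; last exact: ltW.
  apply: itv_int_le => // t /andP[t0 tl].
  apply: (gap t).2; have := norm_dist_lip (g t) x0 bOm.
  have : `|g t - x0| <= t.
    by rewrite -g0; apply: le_trans (gL _ _) _; rewrite mul1r subr0 ger0_norm.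
  have : l <= d x0 by rewrite ge_min lexx orbT.
  by lra.
have I2 : s * itv_int f l L + 0 * (L - l) <= itv_int f' l L.
  rewrite -itv_int_axpb//; apply: itv_int_le => // t _.
  by rewrite addr0; exact: (gap t).1.
have := itv_int_split cf (ltW l0) lL; have := itv_int_split cf' (ltW l0) lL.
move: lg I1 I2; rewrite subr0 mul0r addr0 => + + + E1 E2.
by rewrite E1 E2 mulrDr; lra.
Qed.

End quasihyperbolic_distance.

(** * Quasihyperbolic spheres *)

Section spheres.
Context {R : realType} {X : normedModType R}.
Variable Om : set X.
Hypotheses (oOm : open Om) (bOm : boundary Om !=set0) (cOm : convex_set Om).
Implicit Types (u v w x y z : X) (s t e r m : R).
Local Notation d z := (norm_dist z (boundary Om)).
Local Notation k := (qh_dist Om).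

Lemma qh_dist_near z u v m : Om u -> Om v ->
  `|z - u| <= m -> `|z - v| <= m -> m < d z -> k u v <= `|v - u| / (d z - m).
Proof.
move=> Omu Omv zu zv mz; apply: (qh_dist_segment oOm bOm cOm) => //.
  by rewrite subr_gt0.
move=> t /andP[t0 t1]; rewrite lerBlDr.
apply: le_trans (norm_dist_lip z (u + t *: (v - u)) bOm) _; rewrite lerD2l.
have -> : z - (u + t *: (v - u)) = (1 - t) *: (z - u) + t *: (z - v).
  rewrite scalerBl scale1r -addrA -scalerN -scalerDr opprD addrA -scalerN.
  by congr (_ + _ *: _); rewrite !opprB addrA subrK.
have t1' : 0 <= 1 - t by rewrite subr_ge0.
apply: le_trans (ler_normD _ _) _; rewrite !normrZ !ger0_norm//.
have : (1 - t) * `|z - u| <= (1 - t) * m by rewrite ler_wpM2l.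
have : t * `|z - v| <= t * m by rewrite ler_wpM2l.
by lra.
Qed.

(** This form of the logarithmic bound is stable under limits: at a limit of
    points of the ball lying on the boundary it would force the norm of x0 - y
    to vanish. *)
Lemma qh_ball_norm_le x0 r y : Om x0 -> qh_ball Om x0 r y ->
  `|x0 - y| <= (expR r - 1) * d y.
Proof.
move=> Om0 [Omy ky]; have dy := domain_dist_gt0 oOm bOm Omy.
have a0 : 0 <= `|x0 - y| / d y by rewrite divr_ge0// ltW.
have a1 : 0 < 1 + `|x0 - y| / d y by rewrite ltr_wpDr.
have := le_trans (qh_dist_ln_lb oOm bOm cOm Om0 Omy) ky.
rewrite -ler_expR lnK ?posrE// => le_r.
by rewrite -ler_pdivrMr//; lra.
Qed.

Lemma qh_sphere_sub x0 r z : Om x0 -> 0 <= r -> qh_sphere Om x0 r z -> Om z.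
Proof.
move=> Om0 r0 [/closure_normP cz _]; apply: contrapT => nOmz.
have bz : boundary Om z.
  apply/open_boundaryE => //; split=> //; apply/closure_normP => e /cz.
  by move=> [w [Omw _] zw]; exists w.
have dz := norm_dist_mem_le0 bz.
have K0 : 0 <= expR r - 1 by rewrite subr_ge0 -expR0 ler_expR.
suff : `|x0 - z| <= 0.
  by rewrite normr_le0 subr_eq0 => /eqP x0z; apply: nOmz; rewrite -x0z.
apply/ler_addgt0Pr => e e0; rewrite add0r.
have [|w Bw zw] := cz (e / (expR r - 1 + 1)).
  by rewrite divr_gt0// ltr_wpDl.
have := qh_ball_norm_le Om0 Bw; have := norm_dist_lip w z bOm.
have := ler_distD w x0 z; rewrite (distrC w z).
move: zw; rewrite ltr_pdivlMr ?ltr_wpDl// mulrDr mulr1 => zw t1 t2 t3.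
have : (expR r - 1) * d w <= (expR r - 1) * `|z - w|.
  by rewrite ler_wpM2l//; lra.
by rewrite mulrC; lra.
Qed.

(** Near a point of the domain where k(x0, .) < r this inequality persists, by
    the triangle inequality and [qh_dist_near]. *)
Lemma qh_sphere_ge x0 r z : Om x0 -> Om z -> qh_sphere Om x0 r z -> r <= k x0 z.
Proof.
move=> Om0 Omz [_ nint]; rewrite leNgt; apply/negP => kr; apply: nint.
have dz := domain_dist_gt0 oOm bOm Omz.
have dz2 : 0 < d z / 2 by rewrite divr_gt0.
(* On the ball of radius d(z)/2 the density is at most 2/d(z). *)
pose e := Num.min (d z / 2) ((r - k x0 z) * (d z / 2)).
have e0 : 0 < e by rewrite lt_min dz2 mulr_gt0// subr_gt0.
apply/nbhs_ballP; exists e => //= w; rewrite -ball_normE /= => zw.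
have zw1 : `|z - w| < d z / 2.
  by apply: (lt_le_trans zw); rewrite ge_min lexx.
have zw2 : `|z - w| < (r - k x0 z) * (d z / 2).
  by apply: (lt_le_trans zw); rewrite ge_min lexx orbT.
have Omw : Om w by apply: (ball_dist_sub oOm Omz); lra.
split=> //; apply: le_trans (qh_dist_triangle oOm bOm cOm Om0 Omz Omw) _.
have := @qh_dist_near z z w (d z / 2) Omz Omw.
rewrite subrr normr0 (ltW dz2) (ltW zw1) => /(_ isT isT ltac:(lra)).
have -> : d z - d z / 2 = d z / 2 by lra.
have : `|w - z| / (d z / 2) <= r - k x0 z.
  by rewrite ler_pdivrMr// distrC ltW.
by lra.
Qed.

(** A point y slightly beyond x on the ray from x0 is outside the ball, since x
    is the image of y under a contraction towards x0. *)
Lemma qh_sphere_self x0 x : Om x0 -> Om x -> x0 != x ->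
  qh_sphere Om x0 (k x0 x) x.
Proof.
move=> Om0 Omx x0x; split; first by apply: subset_closure; split.
move=> /nbhs_ballP[e /= e0]; rewrite -ball_normE => eB.
have N0 : 0 < `|x - x0| by rewrite normr_gt0 subr_eq0 eq_sym.
(* With this ratio y lies at distance e/2 from x. *)
pose a := e / (2 * `|x - x0|).
have a0 : 0 < a by rewrite divr_gt0// mulr_gt0.
pose y := x0 + (1 + a) *: (x - x0).
have [Omy ky] : qh_ball Om x0 (k x0 x) y.
  apply: eB => /=; rewrite /y scalerDl scale1r addrA addrCA subrr addr0.
  rewrite opprD addrA subrr add0r normrN normrZ gtr0_norm// /a.
  have -> : e / (2 * `|x - x0|) * `|x - x0| = e / 2 by field; exact: lt0r_neq0.
  by lra.
have s0 : 0 < (1 + a)^-1 by rewrite invr_gt0 addr_gt0.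
have s1 : (1 + a)^-1 < 1 by rewrite invf_lt1 ?addr_gt0// ltrDl.
have yx0 : x0 != y.
  rewrite eq_sym -subr_eq0 /y addrAC subrr add0r scaler_eq0 subr_eq0.
  by rewrite (eq_sym x) (negPf x0x) orbF gt_eqF// addr_gt0.
have := qh_dist_shrink oOm bOm cOm Om0 Omy yx0 s0 s1.
have -> : (1 + a)^-1 *: y + (1 - (1 + a)^-1) *: x0 = x.
  rewrite /y scalerDr scalerA mulVf ?gt_eqF ?addr_gt0// scale1r.
  by rewrite scalerBl scale1r addrC addrA subrK addrC subrK.
by lra.
Qed.

Lemma qh_dist_gt0 u v : Om u -> Om v -> u != v -> 0 < k u v.
Proof.
move=> Omu Omv uv; apply: lt_le_trans (qh_dist_ln_lb oOm bOm cOm Omu Omv).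
rewrite ln_gt0// ltrDl divr_gt0 ?normr_gt0 ?subr_eq0//.
exact: domain_dist_gt0.
Qed.

End spheres.

Lemma ln1D_ge (R : realType) (a : R) : 0 <= a -> a / (1 + a) <= ln (1 + a).
Proof.
move=> a0; have a1 : 0 < 1 + a by rewrite ltr_wpDr.
have E : 1 + - (a / (1 + a)) = (1 + a)^-1.
  by rewrite -[X in X - _](divff (lt0r_neq0 a1)) -mulrBl addrK mul1r.
have : - 1 < - (a / (1 + a)) by rewrite ltrN2 ltr_pdivrMr// mul1r ltrDr.
by move=> /le_ln1Dx; rewrite E lnV ?posrE// lerN2.
Qed.

(** * Geodesics *)

Section geodesics.
Context {R : realType} {X : normedModType R}.
Variables (Om : set X) (x0 x : X) (gamma : R -> X).
Hypotheses (oOm : open Om) (bOm : boundary Om !=set0) (cOm : convex_set Om).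
Hypotheses (gg : qh_geodesic Om gamma) (g0 : gamma 0 = x0) (g1 : gamma 1 = x).
Hypothesis x0x : x0 != x.
Implicit Types (y z : X) (s t e : R).
Local Notation d z := (norm_dist z (boundary Om)).
Local Notation k := (qh_dist Om).
Local Notation r := (k x0 x).
Local Notation S := (qh_sphere Om x0 r).

Lemma geodesic_in t : 0 <= t <= 1 -> Om (gamma t).
Proof. by case: gg => -[[_ H] _ _ _] _ _ t01; apply: H; rewrite in_itv. Qed.

Let Om0 : Om x0.
Proof. by rewrite -g0; apply: geodesic_in; rewrite lexx ler01. Qed.
Let Omx : Om x.
Proof. by rewrite -g1; apply: geodesic_in; rewrite lexx ler01. Qed.

(** The two pieces of the arc length curve of the geodesic join x0 to gamma(t)
    and gamma(t) to x; constant speed fixes their quasihyperbolic lengths. *)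
Lemma geodesic_dist_le t : 0 <= t <= 1 ->
  k x0 (gamma t) <= t * r /\ k (gamma t) x <= (1 - t) * r.
Proof.
move=> t01; have [[pg rg _ _] lg1 lgt] := gg.
have u0 : 0 <= (0 : R) <= 1 by rewrite lexx ler01.
have u1 : 0 <= (1 : R) <= 1 by rewrite lexx ler01.
have cg : {within `[0, 1], continuous gamma} by case: pg.
have [t0 t1] : 0 <= t /\ t <= 1 by apply/andP.
set h := fun s : R => (d (arc_curve gamma s))^-1.
have ch : continuous h := arc_density_continuous oOm bOm pg rg.
have I1 : itv_int h 0 (path_len gamma 1) = r.
  by apply: EFin_inj; rewrite -(qh_lengthE oOm bOm pg rg u1) lg1 g0 g1.
have It : itv_int h 0 (path_len gamma t) = t * r.
  apply: EFin_inj; rewrite -(qh_lengthE oOm bOm pg rg t01) lgt ?in_itv//=.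
  by rewrite lg1 g0 g1.
have lt0 : 0 <= path_len gamma t by exact: len_ge0.
have lt1 : path_len gamma t <= path_len gamma 1 by exact: le_len.
have cL := arc_lip pg rg; have cO := arc_in pg rg.
have := qh_dist_le oOm bOm lt0 cL cO; have := qh_dist_le oOm bOm lt1 cL cO.
rewrite !mul1r -/h It (arc_len pg rg u1) (arc_len pg rg t01) g1.
rewrite -{1}(len0 gamma) (arc_len pg rg u0) g0 => kx k0; split=> //.
by move: I1; rewrite (itv_int_split ch lt0 lt1) It; lra.
Qed.

Lemma geodesic_dist_gt0 : 0 < r. Proof. exact: qh_dist_gt0. Qed.

Lemma sphere_Om z : S z -> Om z.
Proof. by apply: qh_sphere_sub => //; exact: ltW geodesic_dist_gt0. Qed.

Lemma geodesic_sphere_ge t z : 0 <= t <= 1 -> S z ->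
  (1 - t) * r <= k (gamma t) z.
Proof.
move=> t01 Sz; have Omz := sphere_Om Sz.
have [kt _] := geodesic_dist_le t01.
have := qh_sphere_ge oOm bOm cOm Om0 Omz Sz.
by have := qh_dist_triangle oOm bOm cOm Om0 (geodesic_in t01) Omz; lra.
Qed.

Lemma geodesic_end_dist t : 0 <= t <= 1 -> k (gamma t) x = (1 - t) * r.
Proof.
move=> t01; apply/eqP; rewrite eq_le (geodesic_dist_le t01).2/=.
exact/geodesic_sphere_ge/qh_sphere_self.
Qed.

Lemma geodesic_qh_dist_sphere t : 0 <= t <= 1 ->
  qh_dist_set Om (gamma t) S = k (gamma t) x.
Proof.
move=> t01; have Sx : S x by exact: qh_sphere_self.
apply/eqP; rewrite eq_le; apply/andP; split.
  apply: ge_inf; last by exists x.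
  by exists 0 => _ [z _ <-]; exact: qh_dist_ge0.
apply: lb_le_inf; first by exists (k (gamma t) x); exists x.
by move=> _ [z Sz <-]; rewrite geodesic_end_dist//; exact: geodesic_sphere_ge.
Qed.

Lemma geodesic_end_neq t : 0 <= t < 1 -> 0 < `|gamma t - x|.
Proof.
move=> /andP[t0 t1]; rewrite normr_gt0 subr_eq0; apply/eqP => gx.
have t01 : 0 <= t <= 1 by rewrite t0 ltW.
have := geodesic_end_dist t01.
have u1 : 0 <= (1 : R) <= 1 by rewrite lexx ler01.
have := geodesic_end_dist u1; rewrite gx g1 subrr mul0r => -> /esym/eqP.
by rewrite mulf_eq0 subr_eq0 !gt_eqF// geodesic_dist_gt0.
Qed.

(** The lower bound weakens (d(x) - 2 delta)/(d(x) + delta), which is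
    1 - 3 delta/(d(x) + delta). *)
Lemma geodesic_norm_dist_sphere t : 0 <= t < 1 ->
  2 * `|gamma t - x| < d x ->
  1 - 3 * `|gamma t - x| / d x <=
    norm_dist (gamma t) S / `|gamma t - x| <= 1.
Proof.
move=> t01 dt; have dl0 := geodesic_end_neq t01.
have t01' : 0 <= t <= 1 by case/andP: t01 => -> /ltW.
have Omt := geodesic_in t01'.
have Sx : S x by exact: qh_sphere_self.
have D0 : 0 < d x by exact: domain_dist_gt0.
set dl := `|gamma t - x| in dt dl0 *.
apply/andP; split; last first.
  by rewrite ler_pdivrMr// mul1r; exact: norm_dist_le.
rewrite ler_pdivlMr//; apply: le_norm_dist; first by exists x.
move=> y Sy; have Omy := sphere_Om Sy.
have [dly|ydl] := leP dl `|gamma t - y|.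
  apply: (le_trans _ dly); rewrite -[leRHS]mul1r ler_pM2r// gerBl.
  by rewrite divr_ge0 ?mulr_ge0 ?ltW.
have xt : `|x - gamma t| = dl by rewrite distrC.
have xy : `|x - y| <= 2 * dl.
  by have := ler_distD (gamma t) x y; rewrite xt; lra.
have := qh_dist_near oOm bOm cOm Omt Omy (_ : `|x - gamma t| <= 2 * dl) xy dt.
rewrite xt => /(_ ltac:(lra)) ku.
have kl := geodesic_sphere_ge t01' Sy.
have ke := geodesic_end_dist t01'.
have := qh_dist_ln_lb oOm bOm cOm Omt Omx; rewrite -/dl => kln.
have a0 : 0 <= dl / d x by rewrite divr_ge0 ?ltW.
have := ln1D_ge a0.
have -> : dl / d x / (1 + dl / d x) = dl / (d x + dl).
  by field; rewrite !gt_eqF// addr_gt0.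
move=> lnl; have : dl / (d x + dl) <= `|y - gamma t| / (d x - 2 * dl).
  apply: (le_trans lnl); apply: (le_trans kln); rewrite ke.
  exact: le_trans ku.
have D2 : 0 < d x - 2 * dl by rewrite subr_gt0.
rewrite ler_pdivlMr// distrC; apply: le_trans.
have Dd : 0 < d x + dl by rewrite addr_gt0.
have -> : dl / (d x + dl) * (d x - 2 * dl) = (1 - 3 * dl / (d x + dl)) * dl.
  by field; rewrite gt_eqF.
rewrite ler_pM2r// lerB// ler_pM2l ?mulr_gt0// lef_pV2 ?posrE//.
by rewrite lerDl ltW.
Qed.

End geodesics.

(** * The limits *)

Theorem theorem2p10 (R : realType) (X : completeNormedModType R)
    (Om : set X) (x0 x : X) (gamma : R -> X) :
  radon_nikodym_property X ->
  domain Om -> convex_set Om ->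
  Om x0 -> Om x -> x0 <> x ->
  qh_geodesic Om gamma -> gamma 0 = x0 -> gamma 1 = x ->
  let r := qh_dist Om x0 x in
  (norm_dist (gamma t) (qh_sphere Om x0 r) / `|gamma t - gamma 1|
     @[t --> (1 : R)^'-] --> (1 : R)) /\
  (qh_dist_set Om (gamma t) (qh_sphere Om x0 r) / qh_dist Om (gamma t) (gamma 1)
     @[t --> (1 : R)^'-] --> (1 : R)).
Proof.
move=> _ [oOm _ bOm] cOm Om0 Omx /eqP x0x gg g0 g1 r.
have near_left1 (P : R -> Prop) e : 0 < e ->
    (forall t, 0 <= t < 1 -> 1 - t < e -> P t) -> \forall t \near 1^'-, P t.
  move=> e0 PH; near=> t; apply: PH; first by apply/andP; split; near: t;
    [apply: nbhs_left_ge|apply: nbhs_left_lt].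
  rewrite ltrBlDr -ltrBlDl; near: t; apply: nbhs_left_gt.
  by rewrite gtrDl oppr_lt0.
rewrite g1; split; last first.
  apply: cvg_near_cst; apply: (near_left1 _ 1) => // t t01 _.
  have t01' : 0 <= t <= 1 by case/andP: t01 => -> /ltW.
  rewrite (geodesic_qh_dist_sphere oOm bOm cOm gg g0 g1 x0x t01') divff//.
  rewrite (geodesic_end_dist oOm bOm cOm gg g0 g1 x0x t01') mulf_neq0//.
    by rewrite subr_eq0 gt_eqF//; case/andP: t01.
  by rewrite gt_eqF// qh_dist_gt0.
have dx := domain_dist_gt0 oOm bOm Omx.
set D := norm_dist x (boundary Om) in dx.
have [[[cg _] _ _ _] _ _] := gg.
apply/cvgrPdist_le => e e0.
pose eta := Num.min (D / 2) (e * D / 3).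
have eta0 : 0 < eta by rewrite lt_min !divr_gt0// mulr_gt0.
have u1 : 0 <= (1 : R) <= 1 by rewrite lexx ler01.
have [dt dt0 H] := within_continuous_norm cg u1 eta0.
apply: (near_left1 _ dt) => // t t01 tdt.
have t01' : 0 <= t <= 1 by case/andP: t01 => -> /ltW.
have : `|gamma t - x| < eta.
  rewrite -g1 distrC; apply: H => //.
  by rewrite ger0_norm// subr_ge0; case/andP: t01'.
rewrite lt_min => /andP[d1 d2].
have d3 : 2 * `|gamma t - x| < D by lra.
have /andP[lo hi] :=
  geodesic_norm_dist_sphere oOm bOm cOm gg g0 g1 x0x t01 d3.
rewrite ger0_norm ?subr_ge0//.
have : 3 * `|gamma t - x| / D <= e by rewrite ler_pdivrMr//; lra.
by move: lo; rewrite -/r -/D; lra.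
Unshelve. all: by end_near. Qed.
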